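(* Let $m\ge 3$ and $n=2m$. Let $\pi$ be a permutation of $\mathbb{F}_2^m$ and $h_1\colon\mathbb{F}_2^m\to\mathbb{F}_2$ a Boolean function such that $f_1(x,y)=x\cdot\pi(y)+h_1(y)$, $x,y\in\mathbb{F}_2^m$, is a bent function whose unique $m$-dimensional $\mathcal{M}$-subspace is the canonical one, $\mathbb{F}_2^m\times\{0_m\}$. Let $P$ be a permutation of the set $\{1,2,\ldots,n\}$ such that there exists at least one $i\in\{1,\ldots,m\}$ with $P(i)\notin\{1,\ldots,m\}$. Write $x=(x_1,\ldots,x_m)$ and $y=(x_{m+1},\ldots,x_n)$, and let $f_2(x,y)=f_1(x,y)$, $f_3(x,y)=f_1(x_{P(1)},\ldots,x_{P(n)})$, $f_4(x,y)=f_3(x,y)+1$. Set $f=f_1||f_2||f_3||f_4$, that is, $$f(x,y,z_1,z_2)=(1+z_1)f_1(x,y)+z_1f_3(x,y)+z_1z_2,\quad (x,y)\in\mathbb{F}_2^n,\ z_1,z_2\in\mathbb{F}_2.$$ Then $f$ is a bent function in $n+2$ variables and $f$ is outside $\mathcal{M}^{\#}$.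
   Context: A Boolean function $f\colon\mathbb{F}_2^n\to\mathbb{F}_2$ ($n$ even) is bent if $W_f(u)=\sum_{x\in\mathbb{F}_2^n}(-1)^{f(x)+u\cdot x}=\pm 2^{n/2}$ for all $u\in\mathbb{F}_2^n$, where $\cdot$ is the standard scalar product over $\mathbb{F}_2$. $D_aD_bf(x)=f(x+a+b)+f(x+a)+f(x+b)+f(x)$. A linear subspace $V$ of $\mathbb{F}_2^n$ is an $\mathcal{M}$-subspace of $f$ if $D_aD_bf$ is identically $0$ for all $a,b\in V$. $0_m$ is the zero vector of $\mathbb{F}_2^m$. The Maiorana-McFarland class $\mathcal{M}$ in $2m$ variables is the set of functions $f(x,y)=x\cdot\pi(y)+h(y)$, $x,y\in\mathbb{F}_2^m$, with $\pi$ a permutation of $\mathbb{F}_2^m$ and $h$ an arbitrary Boolean function on $\mathbb{F}_2^m$. The completed class $\mathcal{M}^{\#}$ is the set of all functions EA-equivalent to a function in $\mathcal{M}$, where $f,f'$ are EA-equivalent if $f'=f\circ A+l$ for some affine permutation $A$ and some affine Boolean function $l$. The 4-concatenation $f=f_1||f_2||f_3||f_4$ of functions on $\mathbb{F}_2^n$ is the function on $\mathbb{F}_2^{n+2}$ with $f(\cdot,0,0)=f_1$, $f(\cdot,0,1)=f_2$, $f(\cdot,1,0)=f_3$, $f(\cdot,1,1)=f_4$. *)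

(* Defs.v *)
From HB Require Import structures.
From mathcomp Require Import all_boot all_order all_fingroup all_algebra.

Set Implicit Arguments.
Unset Strict Implicit.
Unset Printing Implicit Defensive.

Import GRing.Theory.
Local Open Scope ring_scope.

Notation F2 := ('F_2).

(* Boolean functions in n variables are the functions 'rV[F2]_n -> F2. *)

Definition dotp n (u v : 'rV[F2]_n) : F2 := \sum_(i < n) u 0 i * v 0 i.

Definition sign_of (b : F2) : int := (-1) ^+ (b : nat).

Definition walsh n (f : 'rV[F2]_n -> F2) (u : 'rV[F2]_n) : int :=
  \sum_(x : 'rV[F2]_n) sign_of (f x + dotp u x).

Definition bent n (f : 'rV[F2]_n -> F2) : Prop :=
  ~~ odd n /\
  forall u, walsh f u = 2%:Z ^+ n./2 \/ walsh f u = - (2%:Z ^+ n./2).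

Definition deriv2 n (a b : 'rV[F2]_n) (f : 'rV[F2]_n -> F2) (x : 'rV[F2]_n) : F2 :=
  f (x + a + b) + f (x + a) + f (x + b) + f x.

Definition M_subspace n (f : 'rV[F2]_n -> F2) (V : {vspace 'rV[F2]_n}) : Prop :=
  forall a b, a \in V -> b \in V -> forall x, deriv2 a b f x = 0.

(* Elements of F_2^m x F_2^m are row vectors of length m + m; x is the left
   half and y the right half. *)
Definition MM_fun m (pi : {perm 'rV[F2]_m}) (h : 'rV[F2]_m -> F2)
    (v : 'rV[F2]_(m + m)) : F2 :=
  dotp (lsubmx v) (pi (rsubmx v)) + h (rsubmx v).

(* F_2^m x {0_m}, as the kernel of (x, y) |-> y. *)
Definition canonical_subspace m : {vspace 'rV[F2]_(m + m)} :=
  lker (linfun (@rsubmx F2 1 m m)).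

Definition unique_M_subspace n (d : nat) (f : 'rV[F2]_n -> F2)
    (V : {vspace 'rV[F2]_n}) : Prop :=
  [/\ \dim V = d, M_subspace f V
    & forall W : {vspace 'rV[F2]_n}, \dim W = d -> M_subspace f W -> W = V].

(* The number of variables is an arbitrary N, identified with m + m through e,
   so that the class makes sense for functions on 'rV_(n + 2). *)
Definition MM_class N (f : 'rV[F2]_N -> F2) : Prop :=
  exists (m : nat) (e : N = (m + m)%N)
         (pi : {perm 'rV[F2]_m}) (h : 'rV[F2]_m -> F2),
    forall v, f v = MM_fun pi h (castmx (erefl 1%N, e) v).

Definition affine_permutation n (A : 'rV[F2]_n -> 'rV[F2]_n) : Prop :=
  bijective A /\
  exists (M : 'M[F2]_n) (c : 'rV[F2]_n), forall x, A x = x *m M + c.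

Definition affine_function n (l : 'rV[F2]_n -> F2) : Prop :=
  exists (u : 'rV[F2]_n) (c : F2), forall x, l x = dotp u x + c.

Definition EA_equivalent n (f f' : 'rV[F2]_n -> F2) : Prop :=
  exists (A : 'rV[F2]_n -> 'rV[F2]_n) (l : 'rV[F2]_n -> F2),
    [/\ affine_permutation A, affine_function l
      & forall x, f' x = f (A x) + l x].

Definition completed_MM_class n (f : 'rV[F2]_n -> F2) : Prop :=
  exists g : 'rV[F2]_n -> F2, MM_class g /\ EA_equivalent g f.

(* The last two coordinates of the argument are z_1 and z_2. *)
Definition concat4 n (f1 f2 f3 f4 : 'rV[F2]_n -> F2) (v : 'rV[F2]_(n + 2)) : F2 :=
  let x := lsubmx v in
  let z1 := rsubmx v 0 0 in
  let z2 := rsubmx v 0 1 in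
  if z1 == 0 then (if z2 == 0 then f1 x else f2 x)
  else (if z2 == 0 then f3 x else f4 x).

(* x |-> f (x_{P(1)}, ..., x_{P(n)}): col_perm P x 0 i = x 0 (P i). *)
Definition permute_vars n (P : 'S_n) (f : 'rV[F2]_n -> F2)
    (x : 'rV[F2]_n) : F2 :=
  f (col_perm P x).

Lemma concat4E n (f1 f3 : 'rV[F2]_n -> F2) (x : 'rV[F2]_n) (z : 'rV[F2]_2) :
  concat4 f1 f1 f3 (fun x => f3 x + 1) (row_mx x z)
  = (1 + z 0 0) * f1 x + z 0 0 * f3 x + z 0 0 * z 0 1.
Proof.
have F2P (b : F2) : b = 0 \/ b = 1.
  by case: b => [[|[|k]] //= lt]; [left | right]; apply: val_inj.
have add11 : 1 + 1 = 0 :> F2 by apply: val_inj.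
rewrite /concat4 row_mxKl row_mxKr.
by case: (F2P (z 0 0)) => ->; case: (F2P (z 0 1)) => ->;
  rewrite ?eqxx ?oner_eq0 ?add11 ?addr0 ?add0r ?mul0r ?mul1r ?mulr0 ?addr0 ?add0r.
Qed.

Lemma mem_canonical_subspace m (x y : 'rV[F2]_m) :
  (row_mx x y \in canonical_subspace m) = (y == 0).
Proof. by rewrite memv_ker lfunE /= row_mxKr. Qed.

(* Main.v *)
Require Import Defs.
From mathcomp Require Import all_boot all_order all_fingroup all_algebra.
From mathcomp Require Import ring zify.

(** Bentness is a Walsh transform computation: the transform of the
concatenation at (u, z) is twice that of f1 or, up to sign, twice that of f3,
according to z_2, and permuting the variables of a function only permutes its
transform.

For the second assertion, the tool is that a function of N variables in the
completed Maiorana-McFarland class has an M-subspace W of dimension at least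
N / 2 ([completed_MM_class_M_subspace]): pull back F_2^m x {0} along the linear
part of the affine equivalence. Let N = 2m + 2 and let f be the concatenation
of f1, f1, f3, f3 + 1. On the hyperplane z_1 = 0 the function f is f1 with z_2
a dummy variable, and on z_1 = 1 it is f3 + z_2, where z_2 disappears from
second derivatives. So if U is the projection to the first 2m coordinates of
the part of W lying in z_1 = 0, then U is an M-subspace of f1 and of f3 alike.

Passing from W to U could lose two dimensions: one from imposing z_1 = 0,
one from projecting, if W contains e = (0, 0, 1). It never loses both, because
the second derivative of f at the origin in directions e and w is w_{z_1}: once
e is in W, the whole of W satisfies z_1 = 0. Hence dim U >= m
([concat4_common_M_subspace]), and U contains an m-dimensional V.

By uniqueness for f1, V is the canonical subspace C = F_2^m x {0}. Since f3 is
f1 composed with the coordinate permutation sigma, sigma(V) is an M-subspace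
of f1 as well, so sigma(C) = C. But sigma w has w_{P(i)} as i-th
coordinate, and this vanishes on C when P(i) > m, so the i-th basis vector
lies in C but not in sigma(C). *)

Set Implicit Arguments.
Unset Strict Implicit.
Unset Printing Implicit Defensive.

Import GRing.Theory.
Local Open Scope ring_scope.

(** * The field with two elements and the scalar product *)

Lemma F2P (b : 'F_2) : b = 0 \/ b = 1.
Proof.
by case: b => [[|[|k]] //= lt_k]; [left | right]; apply: val_inj.
Qed.

Lemma addF2_self (b : 'F_2) : b + b = 0.
Proof. by case: (F2P b) => ->; apply: val_inj. Qed.

(** Reduces an identity in characteristic 2 to one that holds in every
commutative ring, given the quantity [z] whose double has to cancel. *)
Lemma eqF2_mod_double (z x y : 'F_2) : x = y + (z + z) -> x = y.
Proof. by rewrite addF2_self addr0. Qed.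

Lemma dotpDl n (u v w : 'rV['F_2]_n) : dotp (u + v) w = dotp u w + dotp v w.
Proof. by rewrite -big_split; apply: eq_bigr => i _; rewrite mxE mulrDl. Qed.

Lemma dotpDr n (u v w : 'rV['F_2]_n) : dotp u (v + w) = dotp u v + dotp u w.
Proof. by rewrite -big_split; apply: eq_bigr => i _; rewrite mxE mulrDr. Qed.

Lemma dotp_row_mx n p (u x : 'rV['F_2]_n) (v y : 'rV['F_2]_p) :
  dotp (row_mx u v) (row_mx x y) = dotp u x + dotp v y.
Proof.
by rewrite /dotp big_split_ord; congr (_ + _); apply: eq_bigr => i _;
  rewrite ?row_mxEl ?row_mxEr.
Qed.

Lemma dotp_col_perm n (P : 'S_n) (u x : 'rV['F_2]_n) :
  dotp (col_perm P u) (col_perm P x) = dotp u x.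
Proof.
rewrite /dotp [RHS](reindex_inj (@perm_inj _ P)).
by apply: eq_bigr => i _; rewrite !mxE.
Qed.

(** * Walsh transforms *)

Lemma sign_ofD b c : sign_of (b + c) = sign_of b * sign_of c.
Proof. by case: (F2P b) => ->; case: (F2P c) => ->. Qed.

(** Substituting the permuted variables in the Walsh sum moves the permutation
onto [u], because a coordinate permutation is orthogonal for the scalar
product. *)
Lemma walsh_permute_vars n (P : 'S_n) (f : 'rV['F_2]_n -> 'F_2) u :
  walsh (permute_vars P f) u = walsh f (col_perm P u).
Proof.
rewrite /walsh [RHS](reindex_inj (h := col_perm P)) /=; last first.
  by apply: can_inj (col_perm P^-1) _ => x; rewrite -col_permM mulVg col_perm1.
by apply: eq_bigr => x _; rewrite dotp_col_perm.
Qed.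

Definition pairF2 (s t : 'F_2) : 'rV['F_2]_2 :=
  \row_j (if j == 0 then s else t).

Lemma pairF2_0 s t : pairF2 s t 0 0 = s. Proof. by rewrite mxE. Qed.
Lemma pairF2_1 s t : pairF2 s t 0 1 = t. Proof. by rewrite mxE. Qed.
Lemma pairF2D s t s' t' : pairF2 s t + pairF2 s' t' = pairF2 (s + s') (t + t').
Proof. by apply/rowP => j; rewrite !mxE; case: ifP. Qed.

Lemma pairF2_00 : pairF2 0 0 = 0.
Proof. by apply/rowP => j; rewrite !mxE if_same. Qed.

Lemma pairF2E (z : 'rV['F_2]_2) : pairF2 (z 0 0) (z 0 1) = z.
Proof.
apply/rowP => j; rewrite mxE; case: ifP => [/eqP-> // | j_neq0].
congr (z 0 _); apply: val_inj.
by case: j j_neq0 => [[|[|k]] lt_k].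
Qed.

Lemma dotp_pairF2 (z : 'rV['F_2]_2) s t :
  dotp z (pairF2 s t) = z 0 0 * s + z 0 1 * t.
Proof.
rewrite /dotp !big_ord_recl big_ord0 addr0.
rewrite pairF2_0; congr (_ + z 0 _ * _); first exact: val_inj.
by rewrite mxE.
Qed.

Lemma sum_F2 (G : 'F_2 -> int) : \sum_s G s = G 0 + G 1.
Proof.
rewrite (bigD1 0) //= (bigD1 1) //= big1 ?addr0 // => s.
by case: (F2P s) => ->.
Qed.

Lemma sum_row_pairF2 n (G : 'rV['F_2]_(n + 2) -> int) :
  \sum_v G v =
  \sum_x \sum_(s : 'F_2) \sum_(t : 'F_2) G (row_mx x (pairF2 s t)).
Proof.
under [RHS]eq_bigr => x _ do rewrite pair_bigA /=.
rewrite pair_bigA /=.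
apply: (reindex (fun q : 'rV['F_2]_n * ('F_2 * 'F_2) =>
          row_mx q.1 (pairF2 q.2.1 q.2.2))).
exists (fun v => (lsubmx v, (rsubmx v 0 0, rsubmx v 0 1))).
  by move=> [x [s t]] _ /=; rewrite row_mxKl row_mxKr pairF2_0 pairF2_1.
by move=> v _ /=; rewrite pairF2E hsubmxK.
Qed.

(** Summing over the two new variables: each half z_1 = 0, z_1 = 1 contributes
the pair z_2 = 0, z_2 = 1, whose terms reinforce or cancel according to
[z 0 1]; the term z_1 z_2 reverses the pattern on the half z_1 = 1. So exactly
one of the two coefficients below is nonzero. *)
Lemma walsh_concat4 n (f1 f3 : 'rV['F_2]_n -> 'F_2) u (z : 'rV['F_2]_2) :
  walsh (concat4 f1 f1 f3 (fun v => f3 v + 1)) (row_mx u z)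
  = (1 + sign_of (z 0 1)) * walsh f1 u
    + (1 - sign_of (z 0 1)) * sign_of (z 0 0) * walsh f3 u.
Proof.
rewrite /walsh sum_row_pairF2 !mulr_sumr -big_split /=.
apply: eq_bigr => x _; rewrite !sum_F2.
rewrite !concat4E !pairF2_0 !pairF2_1 !dotp_row_mx !dotp_pairF2.
rewrite !(mulr0, mul0r, mulr1, mul1r, addr0, add0r) addF2_self.
rewrite !(mul0r, add0r) !sign_ofD.
have -> : sign_of 1 = -1 by [].
ring.
Qed.

Lemma bent_concat4 n (f1 f3 : 'rV['F_2]_n -> 'F_2) :
  bent f1 -> bent f3 -> bent (concat4 f1 f1 f3 (fun v => f3 v + 1)).
Proof.
move=> [even_n bent1] [_ bent3]; split; first by rewrite addn2 /= negbK.
move=> v; rewrite -[v]hsubmxK walsh_concat4 addn2 /= exprS.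
set u := lsubmx v; set z := rsubmx v.
have sign0 : sign_of 0 = 1 by [].
have sign1 : sign_of 1 = -1 by [].
case: (F2P (z 0 1)) => ->; rewrite ?sign0 ?sign1.
  by case: (bent1 u) => ->; [left | right]; ring.
case: (F2P (z 0 0)) => ->; rewrite ?sign0 ?sign1; case: (bent3 u) => ->;
  by [left; ring | right; ring].
Qed.

(** * M-subspaces of functions in the completed class *)

(** Second derivatives kill affine functions, so only the linear part [M] of
the change of variables acts on the directions. *)
Lemma deriv2_affine n p (M : 'M['F_2]_(n, p)) (c : 'rV['F_2]_p)
    (g : 'rV['F_2]_p -> 'F_2) (l : 'rV['F_2]_n -> 'F_2) a b x :
  affine_function l ->
  deriv2 a b (fun v => g (v *m M + c) + l v) x
  = deriv2 (a *m M) (b *m M) g (x *m M + c).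
Proof.
move=> [u [d lE]]; rewrite /deriv2 !lE !dotpDr !mulmxDl.
rewrite -!(addrAC _ c).
(* The constant of l and its linear part at x occur four times, its linear
   part at a and at b twice. *)
by apply: (@eqF2_mod_double (2 * dotp u x + dotp u a + dotp u b + 2 * d)); ring.
Qed.

(** For a fixed right half, a Maiorana-McFarland function is affine in the left
half. *)
Lemma deriv2_MM m (pi : {perm 'rV['F_2]_m}) h a b x :
  rsubmx a = 0 -> rsubmx b = 0 -> deriv2 a b (MM_fun pi h) x = 0.
Proof.
move=> a0 b0; rewrite /deriv2 /MM_fun !raddfD /= a0 b0 !addr0 !dotpDl.
set t := dotp _ _; set s := dotp _ _; set r := dotp _ _; set q := h _.
by apply: (@eqF2_mod_double (2 * t + s + r + 2 * q)); ring.
Qed.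

Lemma leq_dim_cap_lker (K : fieldType) (vT : vectType K) p
    (phi : 'Hom(vT, 'rV[K]_p)) (U : {vspace vT}) :
  (\dim U <= \dim (U :&: lker phi) + p)%N.
Proof.
rewrite -(limg_ker_dim phi U) leq_add2l.
by rewrite (leq_trans (dimvS (subvf _))) // dimvf dim_matrix [leqLHS]mul1n.
Qed.

(** Taking the subspace as a kernel lets the dimension bound follow from
rank-nullity alone, from the number m of equations that cut it out. *)
Lemma completed_MM_class_M_subspace N (f : 'rV['F_2]_N -> 'F_2) :
  completed_MM_class f ->
  exists W : {vspace 'rV['F_2]_N}, M_subspace f W /\ (N <= (\dim W).*2)%N.
Proof.
move=> [g [[m [e [pi [h gE]]]] [A [l [[_ [M [c AE]]] l_aff fE]]]]].
subst N.
pose y := linfun (@rsubmx 'F_2 1 m m \o mulmxr M).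
exists (lker y); split=> [a b | ].
  rewrite !memv_ker !lfunE /= => /eqP a0 /eqP b0 x.
  have -> : deriv2 a b f x =
      deriv2 a b (fun v => MM_fun pi h (v *m M + c) + l v) x.
    by rewrite /deriv2 !fE !AE !gE !castmx_id.
  by rewrite deriv2_affine // deriv2_MM.
have := leq_dim_cap_lker y fullv; rewrite capfv dimvf dim_matrix.
rewrite [X in (X <= _)%N]mul1n -addnn.
by rewrite leq_add2r => le_m; apply: leq_add.
Qed.

(** * Passing to subspaces and permuting the variables *)

Lemma M_subspaceS n (f : 'rV['F_2]_n -> 'F_2) (U V : {vspace 'rV['F_2]_n}) :
  (U <= V)%VS -> M_subspace f V -> M_subspace f U.
Proof. by move=> /subvP sUV fV a b /sUV aV /sUV bV; apply: fV. Qed.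

Lemma exists_subspace_dim (K : fieldType) (vT : vectType K)
    (U : {vspace vT}) d :
  (d <= \dim U)%N -> exists2 V : {vspace vT}, (V <= U)%VS & \dim V = d.
Proof.
move=> le_d; have basisU := vbasisP U.
exists <<take d (vbasis U)>>%VS.
  by apply/span_subvP => v /mem_take /(basis_mem basisU).
have /eqP -> : free (take d (vbasis U)).
  apply: (@catl_free _ _ (drop d (vbasis U))).
  by rewrite cat_take_drop (basis_free basisU).
by rewrite size_takel // size_tuple.
Qed.

Lemma M_subspace_permute_vars n (P : 'S_n) f (V : {vspace 'rV['F_2]_n}) :
  M_subspace (permute_vars P f) V ->
  M_subspace f (linfun (@col_perm 'F_2 1 n P) @: V).
Proof.
move=> fV _ _ /memv_imgP[a aV ->] /memv_imgP[b bV ->] x.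
have := fV a b aV bV (col_perm P^-1 x).
rewrite !lfunE /= /deriv2 /permute_vars !raddfD /=.
by rewrite -col_permM mulgV col_perm1.
Qed.

Lemma dim_limg_col_perm n (P : 'S_n) (V : {vspace 'rV['F_2]_n}) :
  \dim (linfun (@col_perm 'F_2 1 n P) @: V) = \dim V.
Proof.
apply: limg_dim_eq; apply/eqP; rewrite -subv0; apply/subvP => v.
rewrite memv_cap memv_ker lfunE /= memv0 => /andP[_ /eqP v0].
by rewrite -[v]col_perm1 -(mulVg P) col_permM v0 raddf0.
Qed.

(** * M-subspaces of a 4-concatenation *)

(** In directions with z_1 = 0 each half is differentiated separately, and
there f is f1 or f3 plus a function affine in z_2. *)
Lemma deriv2_concat4 n (f1 f3 : 'rV['F_2]_n -> 'F_2) a b x s t r :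
  deriv2 (row_mx a (pairF2 0 s)) (row_mx b (pairF2 0 t))
    (concat4 f1 f1 f3 (fun v => f3 v + 1)) (row_mx x (pairF2 r 0))
  = if r == 0 then deriv2 a b f1 x else deriv2 a b f3 x.
Proof.
rewrite /deriv2 !add_row_mx !pairF2D !concat4E !pairF2_0 !pairF2_1.
rewrite !addr0.
case: (F2P r) => ->; rewrite ?eqxx ?oner_eq0.
  by rewrite !(mul0r, addr0, mul1r).
rewrite addF2_self !(mul0r, add0r, mul1r, addr0).
set p := f3 _; set q := f3 _; set u := f3 _; set v := f3 _.
by apply: (@eqF2_mod_double (s + t)); ring.
Qed.

(** The derivative of f in the direction z_2 is z_1, whose derivative in the
direction [w] is the z_1-coordinate of [w]. *)
Lemma deriv2_concat4_z2 n (f1 f3 : 'rV['F_2]_n -> 'F_2) w :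
  deriv2 (row_mx 0 (pairF2 0 1)) w (concat4 f1 f1 f3 (fun v => f3 v + 1)) 0
  = rsubmx w 0 0.
Proof.
rewrite -[w]hsubmxK row_mxKr -(pairF2E (rsubmx w)) pairF2_0.
set b := lsubmx w; set s := rsubmx w 0 0; set t := rsubmx w 0 1.
have -> : 0 = row_mx 0 (pairF2 0 0) :> 'rV['F_2]_(n + 2).
  by rewrite pairF2_00 row_mx0.
rewrite /deriv2 !add_row_mx !pairF2D !concat4E !pairF2_0 !pairF2_1.
rewrite !(add0r, addr0).
set p := f1 _; set q := f1 _; set u := f3 _; set v := f3 _.
by apply: (@eqF2_mod_double ((1 + s) * p + q + s * u + s * t)); ring.
Qed.

(** At most one dimension is lost: either [W] lies in z_1 = 0, and then only the
projection can lose one, or [W] does not contain the direction z_2, and then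
the projection is injective on the part of [W] in z_1 = 0. *)
Lemma concat4_common_M_subspace n (f1 f3 : 'rV['F_2]_n -> 'F_2)
    (W : {vspace 'rV['F_2]_(n + 2)}) :
  M_subspace (concat4 f1 f1 f3 (fun v => f3 v + 1)) W ->
  exists U, [/\ M_subspace f1 U, M_subspace f3 U & (\dim W <= (\dim U).+1)%N].
Proof.
move=> fW.
pose e : 'rV['F_2]_(n + 2) := row_mx 0 (pairF2 0 1).
pose z1 : 'Hom('rV['F_2]_(n + 2), 'rV['F_2]_1) :=
  linfun (@col 'F_2 1 _ (rshift n 0)).
pose X := linfun (@lsubmx 'F_2 1 n 2).
have z1E w : (w \in lker z1) = (rsubmx w 0 0 == 0).
  rewrite memv_ker lfunE /=; apply/eqP/eqP => [/colP/(_ 0) | w0].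
    by rewrite !mxE.
  by apply/colP => i; rewrite ord1; move: w0; rewrite !mxE.
pose W1 := (W :&: lker z1)%VS; exists (X @: W1)%VS.
have W1P a : a \in (X @: W1)%VS -> exists s, row_mx a (pairF2 0 s) \in W.
  move=> /memv_imgP[w]; rewrite memv_cap z1E => /andP[wW /eqP w0] ->.
  by exists (rsubmx w 0 1); rewrite lfunE /= -w0 pairF2E hsubmxK.
have common (r : 'F_2) a b : a \in (X @: W1)%VS -> b \in (X @: W1)%VS ->
    forall x, (if r == 0 then deriv2 a b f1 x else deriv2 a b f3 x) = 0.
  by move=> /W1P[s aW] /W1P[t bW] x; rewrite -(deriv2_concat4 _ _ _ _ _ s t) fW.
split; [exact: (common 0) | exact: (common 1) |].
have dimW : (\dim W <= \dim W1 + 1)%N := leq_dim_cap_lker z1 W.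
have dimW1 : (\dim W1 <= \dim (W1 :&: lker X) + \dim (X @: W1))%N.
  by rewrite limg_ker_dim.
have kerX : (W1 :&: lker X <= <[e]>)%VS.
  apply/subvP => w; rewrite memv_cap memv_cap z1E memv_ker lfunE /=.
  move=> /andP[/andP[_ /eqP w0] /eqP x0].
  rewrite -[w]hsubmxK x0 -(pairF2E (rsubmx w)) w0.
  case: (F2P (rsubmx w 0 1)) => ->; last exact: memv_line.
  by rewrite pairF2_00 row_mx0 mem0v.
have [eW | eNW] := boolP (e \in W).
  have W1E : W1 = W.
    apply/eqP; rewrite eqEsubv capvSl /=; apply/subvP => w wW.
    by rewrite memv_cap wW z1E -(deriv2_concat4_z2 f1 f3) fW.
  rewrite -W1E (leq_trans dimW1) // -[leqRHS]add1n leq_add2r.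
  by rewrite (leq_trans (dimvS kerX)) // dim_vline leq_b1.
have ker0 : (W1 :&: lker X = 0)%VS.
  apply/eqP; rewrite -subv0; apply/subvP => w wker.
  have /vlineP[k wE] := subvP kerX _ wker.
  move: wker; rewrite wE memv0 => /(subvP (capvSl _ _)) /(subvP (capvSl _ _)).
  case: (F2P k) => ->; rewrite ?scale0r ?eqxx // scale1r.
  by rewrite (negPf eNW).
rewrite ker0 dimv0 add0n in dimW1.
by rewrite -[leqRHS]addn1 (leq_trans dimW) // leq_add2r.
Qed.

(** * The concatenation is bent and outside the completed class *)

Theorem theorem5p1 (m : nat) (hm : (3 <= m)%N)
    (pi : {perm 'rV['F_2]_m}) (h1 : 'rV['F_2]_m -> 'F_2)
    (f1_bent : bent (MM_fun pi h1))
    (f1_unique : unique_M_subspace m (MM_fun pi h1) (canonical_subspace m))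
    (P : 'S_(m + m))
    (hP : exists i : 'I_m, ~~ (P (lshift m i) < m)%N) :
  let f1 := MM_fun pi h1 in
  let f2 := f1 in
  let f3 := permute_vars P f1 in
  let f4 := fun v => f3 v + 1 in
  let f := concat4 f1 f2 f3 f4 in
  bent f /\ ~ completed_MM_class f.
Proof.
move=> f1 f2 f3 f4 f; split.
  apply: bent_concat4 => //; case: f1_bent => even_m bent1.
  by split=> // u; rewrite walsh_permute_vars.
move=> /completed_MM_class_M_subspace[W [fW dimW]].
have [U [f1U f3U dimU]] := concat4_common_M_subspace fW.
have [V sVU dimV] : exists2 V : {vspace _}, (V <= U)%VS & \dim V = m.
  by apply: exists_subspace_dim; rewrite -!mul2n in dimW; lia.
have [_ _ uniq_f1] := f1_unique.
have VE := uniq_f1 V dimV (M_subspaceS sVU f1U).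
have := M_subspace_permute_vars (M_subspaceS sVU f3U).
move=> /(uniq_f1 _ (etrans (dim_limg_col_perm _ _) dimV)); rewrite VE => PE.
(* A preimage w of the i-th basis vector would have w_{P(i)} = 1, while the
   right half of w is zero. *)
have [i hi] := hP.
have : row_mx (delta_mx 0 i) 0 \in canonical_subspace m.
  by rewrite mem_canonical_subspace.
rewrite -PE => /memv_imgP[w]; rewrite -[w]hsubmxK mem_canonical_subspace.
move=> /eqP ->; rewrite lfunE /= => /rowP/(_ (lshift m i)).
rewrite row_mxEl !mxE !eqxx.
case: splitP => [j Pij | j _]; first by move: hi; rewrite Pij ltn_ord.
by rewrite mxE => /eqP; rewrite oner_eq0.
Qed.
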